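(* Let $\{X_n\}_{n\ge1}$ be i.i.d. random variables with common distribution function $F$ satisfying Condition A1 with some $\gamma>0$. Fix a block length $m\ge 2$, and for $k\in\mathbb N$ let $M^{(m)}_{1:k}\le\dots\le M^{(m)}_{k:k}$ be the order statistics of the block maxima $M^{(m)}_1,\dots,M^{(m)}_k$. Let $(\theta_k)$ be a sequence with $\theta_k\in(0,k]$, $\theta_k\to\infty$ and $\theta_k/k\to0$ as $k\to\infty$. Then the estimator $$\hat\gamma(\theta_k,k):=(\log 2)^{-1}\Bigl(\log M^{(m)}_{k-[\theta_k/4]:k}-\log M^{(m)}_{k-[\theta_k/2]:k}\Bigr)$$ satisfies $\hat\gamma(\theta_k,k)\to\gamma$ in probability as $k\to\infty$.
   Context: Block maxima: $M^{(m)}_i:=\max_{(i-1)m<j\le im}X_j$, $i=1,\dots,k$; these are i.i.d. with distribution function $F^m$. For $u\in\mathbb R$, $[u]$ denotes the smallest integer greater than or equal to $u$. Define $V(t):=\bigl(1/(-\log F)\bigr)^{\leftarrow}(t)=F^{\leftarrow}(e^{-1/t})$, where ${}^{\leftarrow}$ denotes the generalised (left-continuous) inverse. Condition A1: (i) $\lim_{t\to\infty}\log V(tx)-\log V(t)=\gamma\log x$ for all $x>0$; (ii) for every $\varepsilon,\delta>0$ there is $t_0=t_0(\varepsilon,\delta)$ such that for $t\ge t_0$ and $x\ge1$, $|V(tx)/V(t)-x^{\gamma}|\le\varepsilon x^{\gamma+\delta}$. *)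

(* Defs.v *)
From HB Require Import structures.
From mathcomp Require Import all_boot all_order all_algebra.
From mathcomp Require Import all_classical all_reals all_analysis.
Set Implicit Arguments. Unset Strict Implicit. Unset Printing Implicit Defensive.
Import Order.TTheory GRing.Theory Num.Theory.
Import numFieldNormedType.Exports.
Local Open Scope classical_set_scope.
Local Open Scope ring_scope.

Section Defs.
Context {d : measure_display} {T : measurableType d} {R : realType}.
Variable P : probability T R.

Definition mutually_independent (X : nat -> {RV P >-> R}) (I : set nat) :=
  forall (s : seq nat) (B : nat -> set R),
    uniq s -> {subset s <= I} -> (forall j, j \in s -> measurable (B j)) ->
    P (\bigcap_(j in [set` s]) (X j @^-1` B j)) =
    (\prod_(j <- s) P (X j @^-1` B j))%E.

Definition has_cdf (X : {RV P >-> R}) (F : R -> R) :=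
  forall x : R, P [set w | X w <= x] = (F x)%:E.

Definition cvg_in_prob (Y : nat -> T -> R) (c : R) :=
  forall eps : R, 0 < eps ->
    (fun k => P [set w | eps <= `|Y k w - c|]) @ \oo --> 0%E.
End Defs.

Section Defs2.
Context {R : realType}.

Definition geninv (F : R -> R) (p : R) : R := inf [set x | p <= F x].

Definition Vfun (F : R -> R) (t : R) : R := geninv F (expR (- t^-1)).

Definition condA1 (F : R -> R) (gamma : R) :=
  (forall x : R, 0 < x ->
     (fun t => ln (Vfun F (t * x)) - ln (Vfun F t)) @ +oo --> gamma * ln x) /\
  (forall eps delta : R, 0 < eps -> 0 < delta ->
     exists t0 : R, forall t x : R, t0 <= t -> 1 <= x ->
       `|Vfun F (t * x) / Vfun F t - x `^ gamma| <= eps * x `^ (gamma + delta)).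

(* block maximum M^{(m)}_i = max_{(i-1)m < j <= im} X_j  (i >= 1, m >= 1) *)
Definition block_max {T : Type} (X : nat -> T -> R) (m i : nat) (w : T) : R :=
  \big[Num.max/X ((i.-1) * m).+1 w]_(((i.-1) * m).+1 <= j < (i * m).+1) X j w.

Definition order_stat (s : seq R) (r : nat) : R :=
  nth 0 (sort (fun x y : R => x <= y) s) r.-1.

(* [u] = smallest integer >= u, as a natural number (u > 0 in our uses) *)
Definition ceil_nat (u : R) : nat := `|Num.ceil u|%N.

Definition gamma_hat {T : Type} (X : nat -> T -> R) (m : nat) (theta : R)
    (k : nat) (w : T) : R :=
  let s := [seq block_max X m i w | i <- iota 1 k] in
  (ln 2)^-1 * (ln (order_stat s (k - ceil_nat (theta / 4)))
               - ln (order_stat s (k - ceil_nat (theta / 2)))).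
End Defs2.

(* Main.v *)
(* The number of block maxima that are at most y is a sum of k pairwise
   uncorrelated indicators with mean F(y)^m each, so Chebyshev's inequality
   controls it; and M_{r:k} <= y iff this number is at least r.  Put
   s_k = m k / theta_k.  Since F (V t) >= exp (-1/t), and F y < exp (-1/t) for
   y < V t, the mean number of block maxima above V(s_k x) is close to
   theta_k / x.  Hence, with r = [theta_k / c], the order statistic M_{k-r:k}
   lies between V(s_k x) and V(s_k x') with probability 1 - O(1 / theta_k)
   whenever x < c < x'.  By A1(i), log M_{k-r:k} - log V(s_k) then tends to
   gamma log c in probability; take c = 4 and c = 2 and subtract. *)

Require Import Defs.
From HB Require Import structures.
From mathcomp Require Import all_boot all_order all_algebra.
From mathcomp Require Import all_classical all_reals all_analysis.
From mathcomp Require Import measurable_realfun ring lra.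
Import Order.TTheory GRing.Theory Num.Theory.
Import numFieldNormedType.Exports.
Local Open Scope classical_set_scope.
Local Open Scope ring_scope.

Set Implicit Arguments.
Unset Strict Implicit.
Unset Printing Implicit Defensive.

(** * Convergence in probability under differences and scaling *)

Section convergence_in_probability.
Context {d : measure_display} {T : measurableType d} {R : realType}.
Variable P : probability T R.

Lemma measurable_dist_ge (f : T -> R) (c e : R) : measurable_fun setT f ->
  measurable [set w | e <= `|f w - c|].
Proof.
move=> mf; have -> : [set w | e <= `|f w - c|] =
  setT `&` (fun w => `|f w - c|) @^-1` `[e, +oo[.
  by apply/seteqP; split => w /=; rewrite in_itv/= andbT; [split|case].
apply: (@measurableT_comp _ _ _ _ _ _ (fun x : R => `|x|)) => //.
exact: measurable_funB.
Qed.

(** A deviation of at least [eps] in the difference forces one of at least [eps / 2] in [Y] or in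
    [Z], so a union bound suffices. Measurability is asked only for large [k], because the ranks
    used later lie between 1 and [k] only eventually. *)
Lemma cvg_in_probB (Y Z : nat -> T -> R) (a b : R) :
  (\forall k \near \oo, measurable_fun setT (Y k)) ->
  (\forall k \near \oo, measurable_fun setT (Z k)) ->
  cvg_in_prob P Y a -> cvg_in_prob P Z b ->
  cvg_in_prob P (fun k w => Y k w - Z k w) (a - b).
Proof.
move=> mY mZ Ya Zb eps eps0; have e2 : 0 < eps / 2 by rewrite divr_gt0.
apply: (@squeeze_cvge _ _ _ _ (cst 0%E) _
  (fun k => P [set w | (eps / 2 <= `|Y k w - a|)%R] +
            P [set w | (eps / 2 <= `|Z k w - b|)%R])%E).
- near=> k; rewrite measure_ge0 /=.
  have mYk : measurable_fun setT (Y k) by near: k.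
  have mZk : measurable_fun setT (Z k) by near: k.
  apply: le_trans (measureU2 _ _ _); [|exact: measurable_dist_ge..].
  apply: le_measure; rewrite ?inE.
  + by apply: measurable_dist_ge; exact: measurable_funB.
  + by apply: measurableU; exact: measurable_dist_ge.
  move=> w /= eYZ; have [|Ye] := leP (eps / 2) `|Y k w - a|; first by left.
  right; have := ler_normB (Y k w - a) (Z k w - b).
  have -> : Y k w - a - (Z k w - b) = Y k w - Z k w - (a - b) by ring.
  lra.
- exact: cvg_cst.
- by rewrite -(adde0 0%E); apply: cvgeD => //; [exact: Ya|exact: Zb].
Unshelve. all: by end_near. Qed.

Lemma cvg_in_probZ (Y : nat -> T -> R) (a c : R) : 0 < c ->
  cvg_in_prob P Y a -> cvg_in_prob P (fun k w => c * Y k w) (c * a).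
Proof.
move=> c0 Ya eps eps0.
have -> : (fun k => P [set w | eps <= `|c * Y k w - c * a|]) =
          (fun k => P [set w | eps / c <= `|Y k w - a|]).
  apply/funext => k; congr (P _); apply/seteqP; split=> w /=;
    by rewrite -mulrBr normrM (gtr0_norm c0) ler_pdivrMr// mulrC.
by apply: Ya; rewrite divr_gt0.
Qed.

End convergence_in_probability.

(** * Chebyshev's inequality for the number of events that occur *)

Section counting.
Context {d : measure_display} {T : measurableType d} {R : realType}.
Variable P : probability T R.

Lemma Lfun2_indic (A : set T) : measurable A -> (\1_A : T -> R) \in Lfun P 2%:E.
Proof.
move=> mA; rewrite inE; apply/andP; split; rewrite inE /=.
  exact: measurable_indic.
rewrite /finite_norm unlock poweR_lty//.
(* The square of an indicator is the indicator itself, so the integral is [P A], which is finite. *)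
rewrite (@eq_integral _ _ _ P _ (EFin \o \1_A)) => [|x _].
  by rewrite integral_indic// setIT (le_lt_trans (probability_le1 P mA))// ltry.
rewrite /= indicE; case: (x \in A).
  by rewrite normr1 powR1.
by rewrite normr0 powR0.
Qed.

Lemma covariance_indic (A B : set T) (p q r : R) :
  measurable A -> measurable B ->
  P A = p%:E -> P B = q%:E -> P (A `&` B) = r%:E ->
  covariance P \1_A \1_B = (r - p * q)%:E.
Proof.
move=> mA mB PA PB PAB.
have sub1 := @Lfun_subset12 _ _ _ P (fin_num_measure P _ measurableT).
rewrite covarianceE; first last.
- exact: Lfun2_mul_Lfun1 (Lfun2_indic mA) (Lfun2_indic mB).
- exact/sub1/Lfun2_indic.
- exact/sub1/Lfun2_indic.
rewrite (_ : \1_A * \1_B = \1_(A `&` B) :> (T -> R)); last by rewrite indicI.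
by rewrite !expectation_indic//; [rewrite PA PB PAB | exact: measurableI].
Qed.

Definition hits (A : nat -> set T) (s : seq nat) : T -> R :=
  \sum_(i <- s) \1_(A i).

(** [D] collects the indices on which the hypotheses hold; it will be the positive integers, as
    blocks are numbered from 1. Independence enters only through pairs, which is what a variance
    sees. *)
Variables (A : nat -> set T) (p : R) (D : {pred nat}).
Hypothesis mA : forall i, i \in D -> measurable (A i).
Hypothesis PA : forall i, i \in D -> P (A i) = p%:E.
Hypothesis PAA : forall i j, i \in D -> j \in D -> i != j ->
  P (A i `&` A j) = (p * p)%:E.

Lemma Lfun2_hits s : {subset s <= D} -> hits A s \in Lfun P 2%:E.
Proof.
move=> sD; rewrite /hits big_seq; apply: rpred_sum => [|? i si]; first exact: lee1n.
exact/Lfun2_indic/mA/sD.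
Qed.

Lemma measurable_hits s : {subset s <= D} -> measurable_fun setT (hits A s).
Proof. by move=> /Lfun2_hits /sub_Lfun_mfun /set_mem. Qed.

Lemma hits_mean s : {subset s <= D} -> ('E_P[hits A s] = ((size s)%:R * p)%:E)%E.
Proof.
rewrite /hits; have sub1 := @Lfun_subset12 _ _ _ P (fin_num_measure P _ measurableT).
elim: s => [|i s IH] sD.
  by rewrite big_nil expectation_cst mul0r.
have iD : i \in D by rewrite sD// mem_head.
have {}sD : {subset s <= D} by move=> j js; rewrite sD// inE js orbT.
rewrite big_cons expectationD; [|exact/sub1/Lfun2_indic/mA|exact/sub1/Lfun2_hits].
rewrite IH// expectation_indic ?PA//; last exact: mA.
by rewrite -EFinD /= mulrS mulrDl mul1r.
Qed.

Lemma covariance_hits i s : i \in D -> {subset s <= D} -> i \notin s ->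
  covariance P (\1_(A i)) (hits A s) = 0%E.
Proof.
rewrite /hits; move=> iD; elim: s => [|j s IH] sD.
  by move=> _; rewrite big_nil covariance_cst_r.
have jD : j \in D by rewrite sD// mem_head.
have {}sD : {subset s <= D} by move=> l ls; rewrite sD// inE ls orbT.
rewrite inE negb_or => /andP[ij ins].
rewrite big_cons covarianceDr ?IH//; [|exact/Lfun2_indic/mA..|exact/Lfun2_hits].
by rewrite (@covariance_indic _ _ p p (p * p)) ?subrr ?add0e//; auto.
Qed.

Lemma hits_variance s : {subset s <= D} -> uniq s ->
  variance P (hits A s) = ((size s)%:R * (p * (1 - p)))%:E.
Proof.
rewrite /hits; elim: s => [|i s IH] sD /=.
  by move=> _; rewrite big_nil variance_cst mul0r.
have iD : i \in D by rewrite sD// mem_head.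
have {}sD : {subset s <= D} by move=> j js; rewrite sD// inE js orbT.
move=> /andP[ins us].
rewrite big_cons varianceD ?IH//; [|exact/Lfun2_indic/mA|exact/Lfun2_hits].
rewrite covariance_hits// mule0 adde0.
(* The variance is the covariance of the indicator with itself, and [A i] meets itself in [A i]: the
   value is [p - p * p]. *)
rewrite /variance (@covariance_indic _ _ p p p) ?setIid; auto.
by rewrite -EFinD mulrS mulrDl mul1r mulrBr mulr1.
Qed.

Lemma hits_chebyshev s (eps : R) : {subset s <= D} -> uniq s -> 0 < eps ->
  (P [set w | (eps <= `|hits A s w - (size s)%:R * p|)%R] <=
   ((size s)%:R * (p * (1 - p)) / eps ^+ 2)%:E)%E.
Proof.
move=> sD us eps0.
have mS := measurable_hits sD.
pose S : {RV P >-> R} := HB.pack (hits A s) (isMeasurableFun.Build _ _ _ _ _ mS).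
have := @chebyshev _ _ _ P S _ eps0.
by rewrite (hits_mean sD) (hits_variance sD us) -EFinM [in X in (_ <= X)%E]mulrC.
Qed.

End counting.

(** * Order statistics and block maxima of a finite list *)

Section order_statistics.
Context {R : realType}.

(** Sorting preserves counts, and in a sorted list the entries at most [y] form a prefix. The range
    of [r] excludes the default value of [nth], and also rank 0, which [r.-1] would confuse with
    rank 1. *)
Lemma order_stat_le (s : seq R) (r : nat) (y : R) : (0 < r <= size s)%N ->
  (order_stat s r <= y) = (r <= count (fun x : R => (x <= y)%R) s)%N.
Proof.
case: r => // r /= rs; rewrite /order_stat /=.
set s' := sort _ s.
have ss : sorted <=%O s' by exact: sort_le_sorted.
have -> : count (fun x : R => (x <= y)%R) s = count (<= y) s'.
  by rewrite count_sort.
apply/idP/idP => [|rc].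
  by apply: contraTT; rewrite -leqNgt -ltNge => cr;
    apply: nth_count_gt; rewrite // cr size_sort.
exact: nth_count_le.
Qed.

Lemma block_max_le {T : Type} (X : nat -> T -> R) (m i : nat) (w : T) (y : R) :
  (0 < m)%N -> (0 < i)%N ->
  (block_max X m i w <= y) =
    all (fun j => X j w <= y) (index_iota (i.-1 * m).+1 (i * m).+1).
Proof.
move=> m0; case: i => // i _; rewrite /block_max /=.
apply/idP/allP => [h j jin|h].
  apply: le_trans h; exact: le_bigmax_seq.
(* The initial value of the maximum is the first entry of the block, which belongs to the block
   since [0 < m]. *)
rewrite big_seq; apply: bigmax_le => //; apply: h.
by rewrite mem_index_iota leqnn ltnS /= mulSn -addn1 addnC leq_add2r.
Qed.

End order_statistics.

(** * The generalised inverse and the tail quantile function [V] *)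

Section tail_quantile.
Context {d : measure_display} {T : measurableType d} {R : realType}.
Variables (P : probability T R) (X : {RV P >-> R}) (F : R -> R).
Hypothesis XF : has_cdf X F.

Lemma has_cdfE : cdf X = EFin \o F.
Proof.
apply/funext => x /=; rewrite -XF /cdf /distribution /pushforward.
by congr (P _).
Qed.

(** [F] tends to 0 at minus infinity. Together with nonemptiness this makes the [inf] in [geninv] a
    true infimum, not a default value. *)
Lemma has_cdf_has_lbound p : 0 < p -> has_lbound [set x | p <= F x].
Proof.
move=> p0; have := @cvg_cdfNy0 _ _ _ _ X; rewrite has_cdfE => /fine_cvg F0.
have [z [_ Fz]] : \forall x \near -oo, F x < p by have /cvgr_lt := F0; apply.
exists (z - 1) => x /= px; rewrite leNgt; apply/negP => xz.
have /Fz /= : x < z by lra.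
by rewrite ltNge px.
Qed.

Lemma has_cdf_nonempty p : p < 1 -> [set x | p <= F x] !=set0.
Proof.
move=> p1; have := @cvg_cdfy1 _ _ _ _ X; rewrite has_cdfE => /fine_cvg F1.
have [z [_ /(_ (z + 1))]] : \forall x \near +oo, p < F x.
  by have /cvgr_gt := F1; apply.
by move=> Fz; exists (z + 1) => /=; apply/ltW/Fz; lra.
Qed.

(** The infimum is attained by right continuity: if [F v < p], then [F] stays below [p] just to the
    right of [v], yet points with [p <= F x] exist arbitrarily close to [v]. *)
Lemma has_cdf_geninv p : 0 < p < 1 -> p <= F (geninv F p).
Proof.
move=> /andP[p0 p1]; set v := geninv F p.
have := @cdf_right_continuous _ _ _ _ X v; rewrite has_cdfE => /fine_cvg /= Fv.
rewrite leNgt; apply/negP => Fvp.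
have : \forall x \near v^'+, F x < p by have /cvgr_lt := Fv; apply.
move=> [e /= e0 h].
have [x px xv] := inf_adherent e0 (conj (has_cdf_nonempty p1) (has_cdf_has_lbound p0)).
have vx : v <= x by apply: ge_inf => //; exact: has_cdf_has_lbound.
have vx' : v < x.
  by rewrite lt_neqAle vx andbT; apply: contraTneq Fvp => ->; rewrite -leNgt.
suff /h /(_ vx') /= : ball v e x by rewrite ltNge px.
rewrite /ball /= ltr0_norm ?subr_lt0// opprB ltrBlDl; exact: xv.
Qed.

Lemma lt_geninv p y : 0 < p -> y < geninv F p -> F y < p.
Proof.
move=> p0; apply: contraTT; rewrite -!leNgt => py.
by apply: ge_inf => //; exact: has_cdf_has_lbound.
Qed.

Lemma Vfun_homo s t : 0 < s -> s <= t -> Vfun F s <= Vfun F t.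
Proof.
move=> s0 st; have t0 := lt_le_trans s0 st.
apply: lb_le_inf.
  by apply: has_cdf_nonempty; rewrite expR_lt1 oppr_lt0 invr_gt0.
move=> x /= tx; apply: ge_inf; first exact/has_cdf_has_lbound/expR_gt0.
by apply: le_trans tx; rewrite ler_expR lerN2 lef_pV2.
Qed.

Lemma le_cdf_Vfun t : 0 < t -> expR (- t^-1) <= F (Vfun F t).
Proof.
by move=> t0; apply: has_cdf_geninv; rewrite expR_gt0 expR_lt1 oppr_lt0 invr_gt0.
Qed.

Lemma cdf_lt_Vfun t y : y < Vfun F t -> F y < expR (- t^-1).
Proof. by apply: lt_geninv; exact: expR_gt0. Qed.

Variable gamma : R.
Hypothesis gamma0 : 0 < gamma.
Hypothesis lnV : forall x : R, 0 < x ->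
  (fun t => ln (Vfun F (t * x)) - ln (Vfun F t)) @ +oo --> gamma * ln x.

(* [ln] is [0] on nonpositive reals, so [Vfun F (t * 2) <= 0] would make the
   difference of logarithms vanish. *)
Lemma Vfun_gt0 : \forall t \near +oo, 0 < Vfun F t.
Proof.
have l2 : 0 < gamma * ln 2 by rewrite mulr_gt0 ?ln_gt0 ?ltr1n.
have [t1 [_ h]] : \forall t \near +oo, 0 < ln (Vfun F (t * 2)) - ln (Vfun F t).
  by have /cvgr_gt := lnV (ltr0Sn R 1); apply.
near=> t.
have t0 : 0 < t / 2 by rewrite divr_gt0//; near: t; exact: nbhs_pinfty_gt.
have th : t1 < t / 2 by rewrite ltr_pdivlMr//; near: t;
  apply: nbhs_pinfty_gt; exact: num_real.
have := h _ th; rewrite divfK// ltNge; apply: contraNT; rewrite -leNgt => V0.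
rewrite !ln0// ?subrr//; apply: le_trans V0; apply: Vfun_homo => //; lra.
Unshelve. all: by end_near. Qed.

(** Monotonicity gives the weak inequality. Equality for large [t] is impossible, since the
    difference of the logarithms tends to [gamma * (ln y - ln x)], which is positive. *)
Lemma Vfun_lt x y : 0 < x -> x < y ->
  \forall t \near +oo, Vfun F (t * x) < Vfun F (t * y).
Proof.
move=> x0 xy; have y0 := lt_trans x0 xy.
have lxy : 0 < gamma * ln y - gamma * ln x.
  by rewrite -mulrBr mulr_gt0// subr_gt0 ltr_ln.
have near_lt : \forall t \near +oo, 0 < (ln (Vfun F (t * y)) - ln (Vfun F t)) -
                                      (ln (Vfun F (t * x)) - ln (Vfun F t)).
  exact: (cvgr_gt _ (cvgB (lnV y0) (lnV x0)) _ lxy).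
near=> t.
have t0 : 0 < t by near: t; exact: nbhs_pinfty_gt.
rewrite lt_neqAle Vfun_homo ?mulr_gt0 ?ler_pM2l ?(ltW xy)// andbT.
have : 0 < (ln (Vfun F (t * y)) - ln (Vfun F t)) -
           (ln (Vfun F (t * x)) - ln (Vfun F t)) by near: t.
by apply: contraTneq => ->; rewrite subrr ltxx.
Unshelve. all: by end_near. Qed.

End tail_quantile.

(** * Distribution of the block maxima and deviation bounds for their order statistics *)

Section block_maxima.
Context {d : measure_display} {T : measurableType d} {R : realType}.
Variables (P : probability T R) (X : nat -> {RV P >-> R}) (F : R -> R) (m : nat).
Hypothesis indX : mutually_independent X [set n | (1 <= n)%N].
Hypothesis XF : forall n, (1 <= n)%N -> has_cdf (X n) F.
Hypothesis m0 : (0 < m)%N.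

Let block i := index_iota (i.-1 * m).+1 (i * m).+1.
Let Xle y (s : seq nat) := \bigcap_(j in [set` s]) (X j @^-1` `]-oo, y]) : set T.
Let M i w := block_max (fun j => X j) m i w.
Let G y i := [set w | M i w <= y].

Lemma measurable_Xle y (s : seq nat) : measurable (Xle y s).
Proof.
apply: bigcap_measurableType => j _.
exact: measurable_funPTI.
Qed.

Lemma probability_Xle y (s : seq nat) : uniq s -> {in s, forall j, (1 <= j)%N} ->
  P (Xle y s) = (F y ^+ size s)%:E.
Proof.
move=> us s1; rewrite indX => //; last first.
  by move=> j /s1; rewrite inE.
rewrite (eq_big_seq (fun=> (F y)%:E)); last first.
  move=> j /s1 j1; rewrite -(XF j1); congr (P _).
elim: s {us s1} => [|j s IH]; first by rewrite big_nil.
by rewrite big_cons IH /= exprS EFinM.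
Qed.

Lemma mem_block i j : (j \in block i) = (i.-1 * m < j <= i * m)%N.
Proof. by rewrite mem_index_iota ltnS. Qed.

Lemma size_block i : (0 < i)%N -> size (block i) = m.
Proof. by case: i => // i _; rewrite size_iota /= mulSn subSS addnK. Qed.

Lemma block_max_leE y i : (0 < i)%N -> G y i = Xle y (block i).
Proof.
move=> i0; apply/seteqP; split => w /=; rewrite /G /= block_max_le//.
  by move=> /allP h j /= /h; rewrite in_itv.
by move=> h; apply/allP => j /h /=; rewrite in_itv.
Qed.

Lemma measurable_block_max_le y i : (0 < i)%N -> measurable (G y i).
Proof. by move=> i0; rewrite block_max_leE//; exact: measurable_Xle. Qed.

Lemma probability_block_max_le y i : (0 < i)%N -> P (G y i) = (F y ^+ m)%:E.
Proof.
move=> i0; rewrite block_max_leE// probability_Xle ?iota_uniq ?size_block//.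
by move=> j; rewrite mem_block => /andP[+ _]; exact: leq_ltn_trans.
Qed.

(** Distinct blocks have disjoint index ranges, so the joint event is a single intersection over
    [2 * m] distinct indices. *)
Lemma probability_block_max_leI y i j : (0 < i)%N -> (0 < j)%N -> i != j ->
  P (G y i `&` G y j) = (F y ^+ m * F y ^+ m)%:E.
Proof.
move=> i0 j0 ij; rewrite !block_max_leE//.
have -> : Xle y (block i) `&` Xle y (block j) = Xle y (block i ++ block j).
  apply/seteqP; split => w.
    by move=> [hi hj] l /=; rewrite mem_cat => /orP[/hi|/hj].
  by move=> h; split => l /= lb; apply: h; rewrite /= mem_cat lb ?orbT.
rewrite probability_Xle ?size_cat ?size_block ?exprD//.
  rewrite cat_uniq !iota_uniq andbT /=; apply/hasPn => l.
  rewrite /= !mem_block => /andP[jl lj]; apply/negP => /andP[il li].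
  case: i j i0 j0 ij jl lj il li => [//|i] [//|j] _ _; rewrite eqSS /= => ij jl lj il li.
  (* A common index [l] is impossible: the block with the smaller number ends at or before the place
     after which the other one starts. *)
  move: ij; rewrite neq_ltn => /orP[] h.
    have := leq_mul2r m i.+1 j; rewrite h orbT => h'.
    by have := leq_trans (leq_ltn_trans h' jl) li; rewrite ltnn.
  have := leq_mul2r m j.+1 i; rewrite h orbT => h'.
  by have := leq_trans (leq_ltn_trans h' il) lj; rewrite ltnn.
by move=> l; rewrite mem_cat !mem_block => /orP[] /andP[+ _]; exact: leq_ltn_trans.
Qed.

Let N y k : T -> R := hits (G y) (iota 1 k).

Definition block_order_stat (r k : nat) (w : T) : R :=
  order_stat [seq block_max (fun j => X j) m i w | i <- iota 1 k] r.

Lemma hits_block_max y k w : N y k w =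
  (count (fun x : R => (x <= y)%R) [seq M i w | i <- iota 1 k])%:R.
Proof.
rewrite /N /hits fct_sumE count_map -sum1_count natr_sum [RHS]big_mkcond /=.
apply: eq_bigr => i _; rewrite indicE.
have -> : (w \in G y i) = (M i w <= y) by apply/idP/idP => [/set_mem|h]; [|exact/mem_set].
by case: ifP.
Qed.

Lemma block_order_stat_le y r k w : (0 < r <= k)%N ->
  (block_order_stat r k w <= y) = (r%:R <= N y k w).
Proof.
by move=> rk; rewrite order_stat_le ?size_map ?size_iota// hits_block_max ler_nat.
Qed.

Let D : {pred nat} := [pred i | (0 < i)%N].

Let iotaD k : {subset iota 1 k <= D}.
Proof. by move=> i; rewrite mem_iota inE => /andP[]. Qed.

Lemma measurable_hits_block_max y k : measurable_fun setT (N y k).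
Proof.
apply: (@measurable_hits _ _ _ P _ D) => // i; exact: measurable_block_max_le.
Qed.

(** The order statistic exceeds [y] exactly when the count [N y k] is below [r]; measurability of
    the count thus replaces any study of sorting. *)
Lemma measurable_block_order_stat r k : (0 < r <= k)%N ->
  measurable_fun setT (block_order_stat r k).
Proof.
move=> rk; apply: (measurability _ (RGenOInfty.measurableE R)) => //.
move=> _ [_ [y ->] <-]; rewrite setTI.
have -> : block_order_stat r k @^-1` `]y, +oo[ =
          N y k @^-1` `]-oo, r%:R[.
  apply/seteqP; split => w /=; rewrite !in_itv/= andbT.
    by rewrite ltNge block_order_stat_le// -ltNge.
  by move=> h; rewrite ltNge block_order_stat_le// -ltNge.
by rewrite -[X in measurable X]setTI; exact: measurable_hits_block_max.
Qed.

Lemma hits_block_max_chebyshev y k (lambda : R) : 0 < lambda ->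
  (P [set w | (lambda <= `|N y k w - k%:R * F y ^+ m|)%R] <=
   (k%:R * (F y ^+ m * (1 - F y ^+ m)) / lambda ^+ 2)%:E)%E.
Proof.
have := @hits_chebyshev _ _ _ P (G y) (F y ^+ m) D _ _ _ (iota 1 k) lambda.
rewrite size_iota; apply => //.
- by move=> i; exact: measurable_block_max_le.
- by move=> i; exact: probability_block_max_le.
- by move=> i j; exact: probability_block_max_leI.
- exact: iota_uniq.
Qed.

Lemma measurable_block_order_stat_le r k y : (0 < r <= k)%N ->
  measurable [set w | block_order_stat r k w <= y].
Proof.
move=> /measurable_block_order_stat mM; rewrite -[X in measurable X]setTI.
by have := mM measurableT _ (measurable_itv `]-oo, y]); congr (measurable (_ `&` _));
  apply/seteqP; split => w /=; rewrite in_itv.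
Qed.

Lemma measurable_block_order_stat_gt r k y : (0 < r <= k)%N ->
  measurable [set w | y < block_order_stat r k w].
Proof.
move=> /(measurable_block_order_stat_le y) /measurableC.
by congr measurable; apply/seteqP; split => w /=; rewrite ltNge; [move/negP|move=> /negP].
Qed.

(** On this event the count is below [r], hence at least [lambda] under its mean [k * F y ^ m]. *)
Lemma probability_block_order_stat_gt r k y (lambda : R) :
  (0 < r <= k)%N -> 0 < lambda -> r%:R + lambda <= k%:R * F y ^+ m ->
  (P [set w | (y < block_order_stat r k w)%R] <=
   (k%:R * (F y ^+ m * (1 - F y ^+ m)) / lambda ^+ 2)%:E)%E.
Proof.
move=> rk l0 rl; apply: le_trans (hits_block_max_chebyshev y k l0).
apply: le_measure; rewrite ?inE.
- exact: measurable_block_order_stat_gt.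
- exact/measurable_dist_ge/measurable_hits_block_max.
move=> w /=; rewrite ltNge block_order_stat_le// -ltNge => h.
rewrite distrC ler_normr; apply/orP; left; lra.
Qed.

Lemma probability_block_order_stat_le r k y (lambda : R) :
  (0 < r <= k)%N -> 0 < lambda -> k%:R * F y ^+ m + lambda <= r%:R ->
  (P [set w | (block_order_stat r k w <= y)%R] <=
   (k%:R * (F y ^+ m * (1 - F y ^+ m)) / lambda ^+ 2)%:E)%E.
Proof.
move=> rk l0 rl; apply: le_trans (hits_block_max_chebyshev y k l0).
apply: le_measure; rewrite ?inE.
- exact: measurable_block_order_stat_le.
- exact/measurable_dist_ge/measurable_hits_block_max.
move=> w /=; rewrite block_order_stat_le// => h.
rewrite ler_normr; apply/orP; left; lra.
Qed.

End block_maxima.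

(** * Elementary bounds for the ceiling, the exponential and the logarithm *)

Lemma ceil_nat_itv {R : realType} (u : R) : 0 <= u ->
  u <= (ceil_nat u)%:R < u + 1.
Proof.
move=> u0; have c0 : 0 <= Num.ceil u by rewrite ceil_ge0 (lt_le_trans _ u0)// ltrN10.
rewrite /ceil_nat natr_absz ger0_norm// ceil_ge /=.
by have := ceilB1_lt u; rewrite intrB ltrBlDr.
Qed.

Lemma expRN_le_inv1D {R : realType} (u : R) : 0 <= u -> expR (- u) <= (1 + u)^-1.
Proof.
move=> u0; rewrite expRN lef_pV2 ?posrE ?expR_gt0 ?expR_ge1Dx//.
by rewrite ltr_pwDl.
Qed.

Lemma ln_dist_lt {R : realType} (x lo hi v a e : R) :
  0 < lo -> lo < x -> x <= hi -> a - e < ln lo - v -> ln hi - v < a + e ->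
  `|ln x - v - a| < e.
Proof.
move=> lo0 lox xhi; have x0 := lt_trans lo0 lox.
have lnlo : ln lo < ln x by rewrite ltr_ln.
have lnhi : ln x <= ln hi by rewrite ler_ln// posrE (lt_le_trans x0).
by rewrite ltr_norml => *; apply/andP; split; lra.
Qed.

(** * Intermediate order statistics of the block maxima *)

Section intermediate_order_statistics.
Context {d : measure_display} {T : measurableType d} {R : realType}.
Variables (P : probability T R) (X : nat -> {RV P >-> R}) (F : R -> R).
Variables (gamma : R) (m : nat) (theta : nat -> R).
Hypothesis indX : mutually_independent X [set n | (1 <= n)%N].
Hypothesis XF : forall n, (1 <= n)%N -> has_cdf (X n) F.
Hypothesis gamma0 : 0 < gamma.
Hypothesis lnV : forall x : R, 0 < x ->
  (fun t => ln (Vfun F (t * x)) - ln (Vfun F t)) @ +oo --> gamma * ln x.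
Hypothesis m0 : (0 < m)%N.
Hypothesis theta0 : forall k, (1 <= k)%N -> 0 < theta k.
Hypothesis theta_y : theta @ \oo --> +oo.
Hypothesis theta_k : (fun k => theta k / k%:R) @ \oo --> 0.

Let s k : R := m%:R * k%:R / theta k.

Let XF1 : has_cdf (X 1%N) F. Proof. exact: XF. Qed.

Lemma cdf_itv x : 0 <= F x <= 1.
Proof.
rewrite -!lee_fin -(XF1 x) measure_ge0 probability_le1//.
exact: (@measurable_funPTI _ _ _ _ (X 1%N) _ (measurable_itv `]-oo, x])).
Qed.

Let m0R : 0 < m%:R :> R. Proof. by rewrite ltr0n. Qed.

Let nbhs_pos : \forall k \near \oo, 0 < k%:R :> R.
Proof. by exists 1%N => // k /=; rewrite ltr0n. Qed.

Let theta_gt0 : \forall k \near \oo, 0 < theta k.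
Proof. by exists 1%N => // k /=; exact: theta0. Qed.

Lemma block_scale_cvgy : s @ \oo --> +oo.
Proof.
have s0 : \forall k \near \oo, 0 < s k.
  by near=> k; rewrite divr_gt0 ?mulr_gt0//; near: k.
apply/(gtr0_cvgV0 s0).
rewrite [X in X @ _ --> _](_ : _ = (fun k => theta k / k%:R * m%:R^-1)); last first.
  by apply/funext => k; rewrite /s /= invf_div invfM mulrAC mulrA.
by rewrite -(mul0r m%:R^-1); apply: cvgMr_tmp.
Unshelve. all: by end_near. Qed.

Let rank k (c : R) := (k - ceil_nat (theta k / c))%N.

Lemma rank_itv (c : R) : 0 < c -> \forall k \near \oo,
  [/\ (0 < rank k c <= k)%N,
      k%:R - theta k / c - 1 < (rank k c)%:R & (rank k c)%:R <= k%:R - theta k / c :> R].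
Proof.
move=> c0; near=> k.
have k0 : 0 < k%:R :> R by near: k.
have t0 : 0 < theta k by near: k.
(* The ceiling is below [k / 2 + 1], which is below [k] once [k > 2]. *)
have k2 : 2 < k%:R :> R by near: k; exists 3%N => // k /=; rewrite ltr_nat.
have tk : theta k < c / 2 * k%:R.
  rewrite -ltr_pdivrMr//; near: k.
  by have /cvgr_lt := theta_k; apply; rewrite divr_gt0.
have tc : theta k / c < k%:R / 2 by rewrite ltr_pdivrMr//; lra.
have /andP[c1 c2] := ceil_nat_itv (ltW (divr_gt0 t0 c0)).
have ck : (ceil_nat (theta k / c) < k)%N by rewrite -(ltr_nat R); lra.
rewrite /rank natrB ?(ltnW ck)// subn_gt0 ck leq_subr; split => //; lra.
Unshelve. all: by end_near. Qed.

(** The mean count is at least [k - theta k / x] and the rank at most [k - theta k / c], a gap of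
    [theta k * D]. The variance is at most [k * (1 - q) <= theta k / x], so Chebyshev gives a bound
    of order [1 / theta k]. *)
Lemma block_order_stat_above (c x : R) : 0 < c -> c < x -> exists C : R,
  \forall k \near \oo,
  (P [set w | (Vfun F (s k * x) < block_order_stat X m (rank k c) k w)%R] <=
   (C / theta k)%:E)%E.
Proof.
move=> c0 cx; have x0 := lt_trans c0 cx.
pose D : R := c^-1 - x^-1.
have D0 : 0 < D by rewrite subr_gt0 ltf_pV2.
exists (x^-1 / D ^+ 2); near=> k.
have k0 : 0 < k%:R :> R by near: k.
have t0 : 0 < theta k by near: k.
have s0 : 0 < s k by rewrite divr_gt0 ?mulr_gt0.
have [rk _ r2] : [/\ (0 < rank k c <= k)%N,
      k%:R - theta k / c - 1 < (rank k c)%:R & (rank k c)%:R <= k%:R - theta k / c :> R].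
  by near: k; exact: rank_itv.
set q := F (Vfun F (s k * x)) ^+ m.
have /andP[F0 F1] := cdf_itv (Vfun F (s k * x)).
have q0 : 0 <= q by exact: exprn_ge0.
have q1 : q <= 1 by exact: exprn_ile1.
have kq : k%:R - theta k / x <= k%:R * q.
  have -> : k%:R - theta k / x = k%:R * (1 - theta k / (k%:R * x)).
    by field; rewrite !gt_eqF.
  rewrite ler_pM2l//.
  apply: (@le_trans _ _ (expR (- (s k * x)^-1) ^+ m)); last first.
    by rewrite lerXn2r ?nnegrE ?expR_ge0//; exact/(le_cdf_Vfun XF1)/mulr_gt0.
  (* The power [m] cancels the factor [m] in [s k], leaving the exponent [- theta k / (k * x)]. *)
  rewrite -expRM_natl; apply: le_trans (expR_ge1Dx _).
  rewrite lerD2l le_eqVlt; apply/orP; left; apply/eqP; rewrite /s.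
  by field; rewrite !gt_eqF.
apply: (le_trans (probability_block_order_stat_gt indX XF m0 rk (mulr_gt0 t0 D0) _)).
  by apply: le_trans kq; rewrite /D mulrBr; lra.
rewrite -/q lee_fin.
have -> : x^-1 / D ^+ 2 / theta k = (theta k / x) / (theta k * D) ^+ 2.
  by field; rewrite !gt_eqF.
rewrite ler_pM2r ?invr_gt0 ?exprn_gt0 ?mulr_gt0//.
apply: (@le_trans _ _ (k%:R * (1 - q))); last by lra.
by rewrite ler_pM2l// ler_piMl// subr_ge0.
Unshelve. all: by end_near. Qed.

(** Let [a = k * (1 - q)] be the mean number of exceedances. Chebyshev is applied with deviation
    [a * K], proportional to [a]: the variance is at most [a], so the bound is [1 / (a * K ^ 2)],
    and the lower bound [theta k / z <= a] is enough. *)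
Lemma block_order_stat_below (c x : R) : 0 < x -> x < c -> exists C : R,
  \forall k \near \oo,
  (P [set w | (block_order_stat X m (rank k c) k w <= Vfun F (s k * x))%R] <=
   (C / theta k)%:E)%E.
Proof.
move=> x0 xc; have c0 := lt_trans x0 xc.
(* Strictness: [V(s x) < V(s y)] gives [F (V(s x)) < exp (-1/(s y))]; passing
   from [y] to [z] absorbs the error of [1 - exp (-u) ~ u]. *)
pose y : R := (2 * x + c) / 3; pose z : R := (x + 2 * c) / 3.
have xy : x < y by rewrite /y; lra.
have yz : y < z by rewrite /y /z; lra.
have zc : z < c by rewrite /z; lra.
have y0 := lt_trans x0 xy; have z0 := lt_trans y0 yz.
(* The relative margin [1 - z / c] is split in two: one [K] pays for the rounding of the rank, the
   other is the Chebyshev deviation. *)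
pose K : R := (1 - z / c) / 2.
have K0 : 0 < K by rewrite divr_gt0// subr_gt0 ltr_pdivrMr// mul1r.
exists (z / K ^+ 2); near=> k.
have k0 : 0 < k%:R :> R by near: k.
have t0 : 0 < theta k by near: k.
have s0 : 0 < s k by rewrite divr_gt0 ?mulr_gt0.
have [rk r1 _] : [/\ (0 < rank k c <= k)%N,
      k%:R - theta k / c - 1 < (rank k c)%:R & (rank k c)%:R <= k%:R - theta k / c :> R].
  by near: k; exact: rank_itv.
have tk : theta k / k%:R < z - y.
  by near: k; have /cvgr_lt := theta_k; apply; rewrite subr_gt0.
have tK : z / K <= theta k by near: k; have /cvgryPge := theta_y; apply.
have V1 : Vfun F (s k * x) < Vfun F (s k * y).
  by near: k; exact: (block_scale_cvgy (Vfun_lt XF1 gamma0 lnV x0 xy)).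
set q := F (Vfun F (s k * x)) ^+ m.
have /andP[F0 F1] := cdf_itv (Vfun F (s k * x)).
have q0 : 0 <= q by exact: exprn_ge0.
have q1 : q <= 1 by exact: exprn_ile1.
have kq : theta k / z <= k%:R * (1 - q).
  pose u : R := theta k / (k%:R * y).
  have u0 : 0 < u by exact: divr_gt0 t0 (mulr_gt0 k0 y0).
  have qu : q <= (1 + u)^-1.
    apply: le_trans (expRN_le_inv1D (ltW u0)).
    have -> : expR (- u) = expR (- (s k * y)^-1) ^+ m.
      rewrite -expRM_natl; congr expR; rewrite /s /u.
      by field; rewrite !gt_eqF.
    by rewrite lerXn2r ?nnegrE ?expR_ge0//; exact/ltW/(cdf_lt_Vfun XF1).
  apply: (@le_trans _ _ (k%:R * (1 - (1 + u)^-1))); last first.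
    by rewrite ler_pM2l// lerD2l lerN2.
  (* In this form [tk] bounds the denominator by [z]. *)
  have -> : k%:R * (1 - (1 + u)^-1) = theta k / (y + theta k / k%:R).
    rewrite /u; field.
    by rewrite (gt_eqF k0) (gt_eqF y0) gt_eqF// addr_gt0// mulr_gt0.
  rewrite ler_pM2l// lef_pV2 ?posrE ?addr_gt0 ?divr_gt0//; lra.
have kq0 : 0 < k%:R * (1 - q) by apply: lt_le_trans kq; exact: divr_gt0.
have kqK : 1 <= k%:R * (1 - q) * K.
  by rewrite -ler_pdivrMr// (le_trans _ kq)// ler_pdivlMr// mulrC mul1r.
apply: (le_trans (probability_block_order_stat_le indX XF m0 rk (mulr_gt0 kq0 K0) _)).
  apply: le_trans (ltW r1); rewrite -/q.
  (* From [theta k / c <= a * (1 - 2 * K)] and [1 <= a * K] follows [theta k / c + 1 + a * K <= a],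
     the required gap. *)
  have : theta k / c <= k%:R * (1 - q) * (z / c).
    by rewrite mulrA ler_pM2r ?invr_gt0// -ler_pdivrMr.
  have -> : z / c = 1 - 2 * K by rewrite /K; field; rewrite gt_eqF.
  move: kqK; set a := k%:R * (1 - q).
  have -> : k%:R * q = k%:R - a by rewrite /a; ring.
  nra.
rewrite -/q lee_fin.
apply: (@le_trans _ _ ((k%:R * (1 - q))^-1 / K ^+ 2)).
  have -> : (k%:R * (1 - q))^-1 / K ^+ 2 =
      k%:R * (1 - q) / (k%:R * (1 - q) * K) ^+ 2.
    by field; rewrite !gt_eqF//; move: kq0; rewrite pmulr_rgt0.
  rewrite ler_pM2r; last by rewrite invr_gt0 exprn_gt0// (mulr_gt0 kq0 K0).
  by rewrite ler_pM2l// ler_piMl// subr_ge0.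
have -> : z / K ^+ 2 / theta k = (theta k / z)^-1 / K ^+ 2.
  by rewrite invf_div mulrAC.
by rewrite ler_pM2r ?invr_gt0 ?exprn_gt0// lef_pV2 ?posrE// divr_gt0.
Unshelve. all: by end_near. Qed.

Lemma measurable_ln_block_order_stat (c : R) : 0 < c ->
  \forall k \near \oo, measurable_fun setT
    (fun w => ln (block_order_stat X m (rank k c) k w) - ln (Vfun F (s k))).
Proof.
move=> c0; apply: filterS (rank_itv c0) => k [rk _ _].
apply: measurable_funB => //.
exact/(measurableT_comp (@measurable_ln R))/measurable_block_order_stat.
Qed.

Lemma ln_block_order_stat_cvg (c : R) : 0 < c ->
  cvg_in_prob P
    (fun k w => ln (block_order_stat X m (rank k c) k w) - ln (Vfun F (s k)))
    (gamma * ln c).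
Proof.
move=> c0 eps eps0.
(* Replacing [c] by [c * expR eta] or [c * expR (- eta)] moves the limit [gamma * ln c] by exactly
   [eps / 2], which leaves room for strict bounds at distance [eps]. *)
pose eta : R := eps / (2 * gamma).
have eta0 : 0 < eta by rewrite divr_gt0// mulr_gt0.
have ce0 a : 0 < c * expR a by rewrite mulr_gt0 ?expR_gt0.
have ln_ce a : gamma * ln (c * expR a) = gamma * ln c + gamma * a.
  by rewrite lnM ?posrE ?expR_gt0// expRK mulrDr.
have ge : gamma * eta = eps / 2 by rewrite /eta; field; rewrite gt_eqF.
have c_lt : c < c * expR eta by rewrite ltr_pMr// expR_gt1.
have lt_c : c * expR (- eta) < c by rewrite gtr_pMr// expR_lt1 oppr_lt0.
have [Ca above] := block_order_stat_above c0 c_lt.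
have [Cb below] := block_order_stat_below (ce0 _) lt_c.
have hi : \forall t \near +oo,
    ln (Vfun F (t * (c * expR eta))) - ln (Vfun F t) < gamma * ln c + eps.
  have /cvgr_lt := lnV (ce0 eta); apply.
  by rewrite ln_ce ge ltrD2l ltr_pdivrMr// ltr_pMr// ltr1n.
have lo : \forall t \near +oo,
    gamma * ln c - eps < ln (Vfun F (t * (c * expR (- eta)))) - ln (Vfun F t).
  have /cvgr_gt := lnV (ce0 (- eta)); apply.
  by rewrite ln_ce mulrN ge ltrD2l ltrN2 ltr_pdivrMr// ltr_pMr// ltr1n.
have V0 : \forall t \near +oo, 0 < Vfun F (t * (c * expR (- eta))).
  exact: (gt0_cvgMly (ce0 (- eta)) cvg_id (Vfun_gt0 XF1 gamma0 lnV)).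
have {}hi := block_scale_cvgy hi.
have {}lo := block_scale_cvgy lo.
have {}V0 := block_scale_cvgy V0.
apply: (@squeeze_cvge _ _ _ _ (cst 0%E) _ (fun k => ((Ca + Cb) / theta k)%:E)).
- near=> k; rewrite measure_ge0 /=.
  have [rk _ _] : [/\ (0 < rank k c <= k)%N,
      k%:R - theta k / c - 1 < (rank k c)%:R & (rank k c)%:R <= k%:R - theta k / c :> R].
    by near: k; exact: rank_itv.
  have mM : measurable_fun setT
      (fun w => ln (block_order_stat X m (rank k c) k w) - ln (Vfun F (s k))).
    by near: k; exact: measurable_ln_block_order_stat.
  have Vp : 0 < Vfun F (s k * (c * expR (- eta))) by near: k.
  have hik : ln (Vfun F (s k * (c * expR eta))) - ln (Vfun F (s k)) < gamma * ln c + eps.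
    by near: k.
  have lok : gamma * ln c - eps <
      ln (Vfun F (s k * (c * expR (- eta)))) - ln (Vfun F (s k)) by near: k.
  set A := [set w | _].
  set U := [set w |
    (Vfun F (s k * (c * expR eta)) < block_order_stat X m (rank k c) k w)%R].
  set L := [set w |
    (block_order_stat X m (rank k c) k w <= Vfun F (s k * (c * expR (- eta))))%R].
  have mU : measurable U by exact: measurable_block_order_stat_gt.
  have mL : measurable L by exact: measurable_block_order_stat_le.
  (* Outside [U] and [L] the order statistic lies between the two quantiles; the lower one is
     positive, so [ln] is monotone there. *)
  have AUL : A `<=` U `|` L.
    move=> w; rewrite /A /U /L /=; move: Vp hik lok.
    move: (block_order_stat _ _ _ _ _) (Vfun _ (_ * (c * expR eta))) => M Vhi.
    move: (Vfun _ (_ * _)) => Vlo Vp hik lok.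
    have [?|MU] := ltP Vhi M; first by left.
    have [?|ML] := leP M Vlo; first by right.
    by rewrite leNgt (ln_dist_lt Vp ML MU lok hik).
  apply: (@le_trans _ _ (P (U `|` L))).
    apply: le_measure => //; rewrite inE; last exact: measurableU.
    exact: measurable_dist_ge mM.
  apply: (le_trans (measureU2 _ _ _)) => //.
  by rewrite mulrDl EFinD; apply: leeD; rewrite /U /L; near: k.
- exact: cvg_cst.
- apply: cvg_EFin; first exact: nearW.
  rewrite -(mulr0 (Ca + Cb)); apply: cvgMl_tmp.
  exact: (iffRL (gtr0_cvgV0 theta_gt0) theta_y).
Unshelve. all: by end_near. Qed.

End intermediate_order_statistics.

Theorem theorem2p1 (d : measure_display) (T : measurableType d) (R : realType)
  (P : probability T R) (X : nat -> {RV P >-> R}) (F : R -> R) (gamma : R)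
  (m : nat) (theta : nat -> R) :
  mutually_independent X [set n | (1 <= n)%N] ->
  (forall n, (1 <= n)%N -> has_cdf (X n) F) ->
  0 < gamma -> condA1 F gamma ->
  (2 <= m)%N ->
  (forall k, (1 <= k)%N -> 0 < theta k <= k%:R) ->
  theta @ \oo --> +oo ->
  (fun k => theta k / k%:R) @ \oo --> 0 ->
  cvg_in_prob P (fun k w => gamma_hat (fun j => X j) m (theta k) k w) gamma.
Proof.
move=> indX XF gamma0 [lnV _] m2 theta_itv theta_y theta_k.
have m0 : (0 < m)%N by exact: ltnW.
have theta0 k : (1 <= k)%N -> 0 < theta k by move=> /theta_itv /andP[].
have ln2 : 0 < ln 2 :> R by rewrite ln_gt0// ltr1n.
have -> : gamma = (ln 2)^-1 * (gamma * ln 4 - gamma * ln 2).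
  have -> : 4 = 2 * 2 :> R by ring.
  by rewrite lnM ?posrE//; field; rewrite gt_eqF.
(* The centring [ln V(s_k)] is the same for [c = 4] and [c = 2], so it cancels in the difference. *)
pose Y c k w := ln (block_order_stat X m (k - ceil_nat (theta k / c)) k w)
  - ln (Vfun F (m%:R * k%:R / theta k)).
have mY (c : R) : 0 < c -> \forall k \near \oo, measurable_fun setT (Y c k).
  exact: (measurable_ln_block_order_stat X F m0 theta0 theta_k).
have cvgY (c : R) : 0 < c -> cvg_in_prob P (Y c) (gamma * ln c).
  exact: (ln_block_order_stat_cvg indX XF gamma0 lnV m0 theta0 theta_y theta_k).
have -> : (fun k w => gamma_hat (fun j => X j) m (theta k) k w) =
    (fun k w => (ln 2)^-1 * (Y 4 k w - Y 2 k w)).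
  apply/funext => k; apply/funext => w; rewrite /gamma_hat /Y /block_order_stat.
  by congr (_ * _); ring.
apply: cvg_in_probZ; first by rewrite invr_gt0.
by apply: cvg_in_probB; [exact: mY|exact: mY|exact: cvgY|exact: cvgY].
Qed.
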